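(* Let $\emptyset\neq\mathcal{Y}\subseteq\mathbb{R}^n$, let $\mathbf{\Psi}:\mathcal{Y}\to I(\mathbb{R})$ be an interval-valued function and let $u\in\mathcal{Y}$. Then $u$ is a weak efficient solution of $\mathbf{\Psi}$ if and only if $$(\mathbf{0},0)\in\partial^w\mathbf{\Psi}(u)\oplus\mathcal{N}^c_{\mathcal{Y}}(u),$$ where $(\mathbf{0},0)$ denotes the zero of $I(\mathbb{R})^n\times\mathbb{R}_+$ and $\mathcal{N}^c_{\mathcal{Y}}(u)$ is the augmented normal cone to $\mathcal{Y}$ at $u$.
   Context: $I(\mathbb{R})$ is the set of compact intervals $\mathbf{X}=[\underline{x},\overline{x}]$, $\underline{x}\le\overline{x}$; a real number $c$ is identified with $[c,c]$; $\mathbf{0}=[0,0]$ (also used for the interval vector with all components $[0,0]$). Operations: $\mathbf{X}\oplus\mathbf{Y}=[\underline{x}+\underline{y},\overline{x}+\overline{y}]$; $\lambda\odot\mathbf{X}=[\min\{\lambda\underline{x},\lambda\overline{x}\},\max\{\lambda\underline{x},\lambda\overline{x}\}]$ for $\lambda\in\mathbb{R}$; $gH$-difference $\mathbf{X}\ominus_{gH}\mathbf{Y}=[\min\{\underline{x}-\underline{y},\overline{x}-\overline{y}\},\max\{\underline{x}-\underline{y},\overline{x}-\overline{y}\}]$. Order: $\mathbf{X}\preceq\mathbf{Y}$ iff $\underline{x}\le\underline{y}$ and $\overline{x}\le\overline{y}$. For $\widehat{\mathbf{G}}=(\mathbf{G}_1,\dots,\mathbf{G}_n)\in I(\mathbb{R})^n$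 and $d\in\mathbb{R}^n$, $\widehat{\mathbf{G}}^\top\odot d=\bigoplus_{i=1}^n d_i\odot\mathbf{G}_i$. $\mathbb{R}_+=[0,\infty)$ and $\|\cdot\|$ is the Euclidean norm. The $gH$-weak subdifferential of $\mathbf{\Psi}$ at $u\in\mathcal{Y}$ is $$\partial^w\mathbf{\Psi}(u)=\{(\widehat{\mathbf{G}},c)\in I(\mathbb{R})^n\times\mathbb{R}_+:\ \widehat{\mathbf{G}}^\top\odot(y-u)\ominus_{gH}c\|y-u\|\preceq\mathbf{\Psi}(y)\ominus_{gH}\mathbf{\Psi}(u)\ \ \forall y\in\mathcal{Y}\}.$$ The augmented normal cone to $\mathcal{Y}$ at $u$ is $$\mathcal{N}^c_{\mathcal{Y}}(u)=\{(\widehat{\mathbf{G}},c)\in I(\mathbb{R})^n\times\mathbb{R}_+:\ \widehat{\mathbf{G}}^\top\odot(y-u)\ominus_{gH}c\|y-u\|\preceq\mathbf{0}\ \ \forall y\in\mathcal{Y}\}.$$ For sets $A,B\subseteq I(\mathbb{R})^n\times\mathbb{R}_+$, $A\oplus B=\{(\widehat{\mathbf{G}}\oplus\widehat{\mathbf{H}},c+d):(\widehat{\mathbf{G}},c)\in A,(\widehat{\mathbf{H}},d)\in B\}$, with $\oplus$ componentwise on interval vectors. A point $u\in\mathcal{Y}$ is a weak efficient solution (weak efficient point) of $\mathbf{\Psi}$ if $\mathbf{\Psi}(u)\preceq\mathbf{\Psi}(y)$ for all $y\in\mathcal{Y}$. *)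

(* Defs.v *)
From HB Require Import structures.
From mathcomp Require Import all_boot all_order all_algebra.
From mathcomp Require Import boolp classical_sets reals interval_inference.

Set Implicit Arguments.
Unset Strict Implicit.
Unset Printing Implicit Defensive.

Import Order.TTheory GRing.Theory Num.Theory.

Local Open Scope classical_set_scope.
Local Open Scope ring_scope.

(* [cint R] is I(R): a nonempty compact interval [lo X, hi X] is given by its
   endpoints. *)
Record cint (R : realType) := CInt {
  lo : R;
  hi : R;
  lo_le_hi : lo <= hi
}.

Section CompactInterval.
Variable R : realType.
Implicit Types X Y Z : cint R.

Lemma cint_eq X Y : lo X = lo Y -> hi X = hi Y -> X = Y.
Proof.
case: X Y => [a b ab] [c d cd] /= ac bd; move: ab cd; rewrite ac bd => ab cd.
by rewrite (bool_irrelevance ab cd).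
Qed.

HB.instance Definition _ := gen_eqMixin (cint R).
HB.instance Definition _ := gen_choiceMixin (cint R).

Definition icst (c : R) : cint R := CInt (lexx c).

Definition iadd X Y : cint R := CInt (lerD (lo_le_hi X) (lo_le_hi Y)).

Lemma iaddA : associative iadd.
Proof. by move=> X Y Z; apply: cint_eq; rewrite /= addrA. Qed.

Lemma iaddC : commutative iadd.
Proof. by move=> X Y; apply: cint_eq; rewrite /= addrC. Qed.

Lemma iadd0 : left_id (icst 0) iadd.
Proof. by move=> X; apply: cint_eq; rewrite /= add0r. Qed.

(* From here on, [X + Y], [0] and [\sum] denote the interval addition and the
   interval [0, 0], and, on ['rV[cint R]_n], their componentwise versions. *)
HB.instance Definition _ :=
  GRing.isNmodule.Build (cint R) iaddA iaddC iadd0.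

Lemma min_le_max (a b : R) : Num.min a b <= Num.max a b.
Proof. by rewrite ge_min !le_max lexx. Qed.

Definition minmax (a b : R) : cint R := CInt (min_le_max a b).

Definition iscale (l : R) X : cint R := minmax (l * lo X) (l * hi X).

Definition gHsub X Y : cint R := minmax (lo X - lo Y) (hi X - hi Y).

Definition ile X Y : Prop := lo X <= lo Y /\ hi X <= hi Y.

End CompactInterval.

Section WeakSubdifferential.
Variables (R : realType) (n : nat).

(* The norm [`|x|] of the library on matrices is the sup norm. *)
Definition enorm (x : 'rV[R]_n) : R := Num.sqrt (\sum_i x 0 i ^+ 2).

Definition idot (G : 'rV[cint R]_n) (d : 'rV[R]_n) : cint R :=
  \sum_i iscale (d 0 i) (G 0 i).

Definition ivec_nonneg : Type := 'rV[cint R]_n * {nonneg R}.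

(* A function on the set Y is a function on the type [{x | x \in Y}] to which
   Y coerces. *)
Definition weak_subdifferential (Y : set 'rV[R]_n) (Psi : Y -> cint R)
    (u : Y) : set ivec_nonneg :=
  [set Gc | forall y : Y,
    ile (gHsub (idot Gc.1 (val y - val u))
               (icst (Gc.2%:num * enorm (val y - val u))))
        (gHsub (Psi y) (Psi u))].

Definition augmented_normal_cone (Y : set 'rV[R]_n) (u : Y) :
    set ivec_nonneg :=
  [set Gc | forall y : Y,
    ile (gHsub (idot Gc.1 (val y - val u))
               (icst (Gc.2%:num * enorm (val y - val u))))
        0].

Definition set_add (A B : set ivec_nonneg) : set ivec_nonneg :=
  [set (a.1 + b.1, (a.2%:num + b.2%:num)%:nng) | a in A & b in B].

Definition weak_efficient (Y : set 'rV[R]_n) (Psi : Y -> cint R) (u : Y) :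
    Prop :=
  forall y : Y, ile (Psi u) (Psi y).

End WeakSubdifferential.

(* Main.v *)
Require Import Defs.
From mathcomp Require Import all_boot all_order all_algebra.
From mathcomp Require Import boolp classical_sets reals interval_inference.

(** Only degenerate intervals have an additive inverse in I(R). Hence a
    decomposition of (0, 0) consists of (g, 0) and (- g, 0) for a real vector
    g: the cone condition says <g, y - u> >= 0 on Y, and the subgradient
    condition then gives 0 <= Psi y - Psi u. Conversely take g = 0. *)

Import Order.TTheory GRing.Theory Num.Theory.

Local Open Scope classical_set_scope.
Local Open Scope ring_scope.

Lemma minmaxxx (R : realType) (a : R) : minmax a a = icst a.
Proof. by apply: cint_eq; rewrite /= ?minxx ?maxxx. Qed.

Lemma iscale_icst (R : realType) (l a : R) : iscale l (icst a) = icst (l * a).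
Proof. exact: minmaxxx. Qed.

Lemma gHsub_icst (R : realType) (a b : R) :
  gHsub (icst a) (icst b) = icst (a - b).
Proof. exact: minmaxxx. Qed.

Lemma icstD (R : realType) (a b : R) : icst a + icst b = icst (a + b).
Proof. exact: cint_eq. Qed.

Lemma sum_icst (R : realType) (I : finType) (f : I -> R) :
  \sum_i icst (f i) = icst (\sum_i f i).
Proof.
apply: (big_ind2 (fun X a => X = icst a)) => // X a Z b -> ->.
exact: icstD.
Qed.

(** On degenerate entries the min and max inside [iscale] coincide, so [idot] becomes the Euclidean
    inner product with the real vector [g]. *)
Lemma idot_icst (R : realType) (n : nat) (G : 'rV[cint R]_n) (g : 'I_n -> R)
    (d : 'rV[R]_n) :
  (forall i, G 0 i = icst (g i)) -> idot G d = icst (\sum_i d 0 i * g i).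
Proof.
move=> Gg; rewrite /idot -sum_icst; apply: eq_bigr => i _.
by rewrite Gg iscale_icst.
Qed.

Lemma idot0 (R : realType) (n : nat) (d : 'rV[R]_n) :
  idot (0 : 'rV[cint R]_n) d = icst 0.
Proof.
rewrite (idot_icst _ _ _ (fun=> 0)) => [|i]; last by rewrite mxE.
by rewrite big1 // => i _; rewrite mulr0.
Qed.

(** Negation reverses order: [lo Z <= hi Z] reads [- lo X <= - hi X], which forces
    [hi X <= lo X]. *)
Lemma iadd_eq0 (R : realType) (X Z : cint R) :
  X + Z = 0 -> X = icst (lo X) /\ Z = icst (- lo X).
Proof.
move=> XZ0; have /eqP : lo X + lo Z = 0 := f_equal (@lo R) XZ0.
have /eqP : hi X + hi Z = 0 := f_equal (@hi R) XZ0.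
rewrite !addr_eq0 -!eqr_oppLR => /eqP hiZ /eqP loZ.
have hiX : hi X = lo X.
  apply/eqP; rewrite eq_le lo_le_hi andbT.
  by rewrite -lerN2 hiZ loZ lo_le_hi.
by split; apply: cint_eq => //=; rewrite -hiZ hiX.
Qed.

(** Being below the minimum of the two endpoint differences already means being below both, and
    hence below their maximum. *)
Lemma icst_le_gHsub (R : realType) (a : R) (X Z : cint R) :
  ile (icst a) (gHsub X Z) <-> a <= lo X - lo Z /\ a <= hi X - hi Z.
Proof.
rewrite /ile /= le_min le_max; split=> [[/andP[]] //|[-> ->]].
by [].
Qed.

Theorem theorem13 (R : realType) (n : nat) (Y : set 'rV[R]_n)
    (Y_neq0 : Y !=set0) (Psi : Y -> cint R) (u : Y) :
  weak_efficient Psi u <->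
  set_add (weak_subdifferential Psi u) (augmented_normal_cone u)
    ((0, 0%:nng) : ivec_nonneg R n).
Proof.
split=> [Psi_min|].
  exists (0, 0%:nng) => [y|] /=.
    rewrite idot0 gHsub_icst mul0r subrr icst_le_gHsub !subr_ge0.
    exact: Psi_min.
  exists (0, 0%:nng) => [y|] /=.
    by rewrite idot0 gHsub_icst mul0r subrr; split.
  by congr pair; [rewrite addr0|apply/val_inj; rewrite /= addr0].
move=> [[G c] sub_G] [[H d] cone_H] [/rowP GH0 cd0].
(* Both constants are nonnegative with sum zero, so both vanish, and the norm terms with them. *)
move/eqP: cd0; rewrite paddr_eq0// => /andP[/eqP c0 /eqP d0] y.
(* The real vector g consists of the lower endpoints of [G]. *)
have GHi i : G 0 i = icst (lo (G 0 i)) /\ H 0 i = icst (- lo (G 0 i)).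
  by apply: iadd_eq0; have := GH0 i; rewrite !mxE.
have := cone_H y; rewrite /= d0 (idot_icst _ _ _ _ _ (fun i => (GHi i).2)).
rewrite gHsub_icst mul0r subr0 => -[/= + _].
under eq_bigr do rewrite mulrN.
rewrite sumrN oppr_le0 => g_ge0.
have := sub_G y; rewrite /= c0 (idot_icst _ _ _ _ _ (fun i => (GHi i).1)).
rewrite gHsub_icst mul0r subr0 icst_le_gHsub => -[leL leH].
(* The inner product of g with y - u separates 0 from both endpoint differences of [Psi]. *)
by split; rewrite -subr_ge0; apply: le_trans g_ge0 _.
Qed.
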